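(* Let $H$ be a separable complex Hilbert space with orthonormal basis $\{e_n\}_{n=-\infty}^{+\infty}$, let $\{\beta_n\}_{n=-\infty}^{+\infty}$ be a bounded sequence of complex numbers, and let $T\in B(H)$ be the bilateral weighted shift with $Te_n=\beta_n e_{n+1}$ for all $n\in\mathbb{Z}$. Suppose $T$ is hyponormal. If $0<|\beta_n|<|\beta_{n+1}|$ for all $n\in\mathbb{Z}$, then $T$ is near subnormal if and only if the sequence $$\left\{\beta_n\left(\frac{|\beta_{n+1}|^2-|\beta_n|^2}{|\beta_n|^2-|\beta_{n-1}|^2}\right)^{\frac12}\right\}_{n=-\infty}^{+\infty}$$ is bounded.
   Context: $B(H)$ is the algebra of all bounded linear operators on $H$. For $A\in B(H)$ put $Q_A=A^*A-AA^*$; $A$ is hyponormal if $Q_A\ge 0$. For $A,D\in B(H)$ with $D\ge 0$, $A$ is called $D$-near subnormal if there exists a constant $m>0$ such that $D\ge mA^*DA$. A hyponormal operator $A$ is called near subnormal if it is $Q_A$-near subnormal, i.e. if there exists a constant $m>0$ such that $Q_A\ge mA^*Q_AA$. *)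

(* Defs.v *)
From mathcomp Require Import all_boot all_order all_algebra.
From mathcomp Require Export complex.
From mathcomp Require Import all_classical all_reals all_analysis.
Import Order.TTheory GRing.Theory Num.Theory.
Import numFieldNormedType.Exports.

Set Implicit Arguments.
Unset Strict Implicit.
Unset Printing Implicit Defensive.

Local Open Scope classical_set_scope.
Local Open Scope ring_scope.
Local Open Scope complex_scope.

(* A complex Hilbert space is a complete normed module [H] over [R[i]] with an
   inner product [dot : {dot H for Num.conj}] (linear in the first argument,
   conjugate-linear in the second) such that [`|x| ^+ 2 = dot x x].  On [R[i]],
   [0 <= z] means that [z] is real and nonnegative, and norms take values in
   [R[i]]. *)

Definition separable_space (X : topologicalType) :=
  exists2 S : set X, countable S & dense S.

Definition bounded_family (R : realType) (I : Type) (u : I -> R[i]) :=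
  exists M : R, forall n, `|u n| <= M%:C.

Section HilbertSpace.
Context {R : realType} {H : completeNormedModType R[i]}.

Definition lin_span (I : eqType) (e : I -> H) : set H :=
  [set x | exists (s : seq I) (c : I -> R[i]), x = \sum_(i <- s) c i *: e i].

Definition bounded_operator (A : {linear H -> H}) :=
  exists M : R, forall x, `|A x| <= M%:C * `|x|.

Variable dot : {dot H for @Num.conj R[i]}.

Definition orthonormal_basis (I : eqType) (e : I -> H) :=
  (forall i j, dot (e i) (e j) = (i == j)%:R) /\ dense (lin_span e).

(* [adjoint A y] is the vector [z] such that [dot (A x) y = dot x z] for all
   [x].  It exists (Riesz) and is unique when [A] is a bounded operator; the
   value [0] is used when there is no such vector. *)
Definition adjoint (A : H -> H) : H -> H :=
  fun y => xget 0 [set z | forall x, dot (A x) y = dot x z].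

Definition positive_operator (A : H -> H) := forall x, 0 <= dot (A x) x.

Definition operator_le (A B : H -> H) := positive_operator (B \- A).

Definition self_commutator (A : H -> H) : H -> H :=
  (adjoint A \o A) \- (A \o adjoint A).

Definition hyponormal (A : H -> H) := positive_operator (self_commutator A).

(* Meant for positive [D]. *)
Definition near_subnormal_wrt (D A : H -> H) :=
  exists2 m : R, 0 < m &
    operator_le (fun x => m%:C *: adjoint A (D (A x))) D.

Definition near_subnormal (A : H -> H) :=
  hyponormal A /\ near_subnormal_wrt (self_commutator A) A.

End HilbertSpace.

(* Main.v *)
From HB Require Import structures.
Require Import Defs.
From mathcomp Require Import all_boot all_order all_algebra.
From mathcomp Require Import all_classical all_reals all_analysis.
From mathcomp Require Import ring lra.
Import Order.TTheory GRing.Theory Num.Theory.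
Import numFieldNormedType.Exports.

Set Implicit Arguments.
Unset Strict Implicit.
Unset Printing Implicit Defensive.

Local Open Scope classical_set_scope.
Local Open Scope ring_scope.

(** Why the theorem holds.  In the basis [e], the adjoint of the shift sends
   [e n] to [(beta (n - 1))^* *: e (n - 1)], so the self-commutator [Q] of [T]
   is diagonal with entries [d n = `|beta n|^2 - `|beta (n - 1)|^2], and
   [T^* Q T] is diagonal with entries [`|beta n|^2 * d (n + 1)].  A bounded
   diagonal operator is positive exactly when its entries are nonnegative
   ([diagonal_positiveP]), so [Q >= m T^* Q T] says
   [`|beta n|^2 * d (n + 1) / d n <= m^-1] for all [n].  The left-hand side is
   the squared modulus of the [n]-th term of the sequence in the theorem, hence
   some [m > 0] works if and only if that sequence is bounded
   ([bounded_family_sqrtP]).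

   The analytic content is that [T] has an adjoint on all of [H], i.e. that
   [adjoint dot T] is a genuine bounded linear operator rather than partly the
   default value [0].  The vectors [y] for which some [z] represents
   [x |-> dot (T x) y] form a subspace; it contains every [e n], where [z] is
   explicit, and it is closed because [H] is complete and [z] depends on [y] in
   a Lipschitz way ([adjoint_domain_closed]).  As the span of [e] is dense, this
   subspace is [H].  The same density argument, applied to continuous functions
   ([eq_on_dense]), reduces each remaining claim about operators to finite
   linear combinations of basis vectors. *)

(** * Dense subsets *)

Section Dense.
Context {X Y : topologicalType}.

Lemma dense_closure (S : set X) : dense S -> closure S = setT.
Proof.
move=> dS; apply/seteqP; split => // x _ B /nbhs_interior Bx.
have [|y [By Sy]] := dS B^° _ (@open_interior _ B).
  by exists x; exact: nbhs_singleton.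
by exists y; split => //; exact: interior_subset.
Qed.

Lemma eq_on_dense (S : set X) (f g : X -> Y) : hausdorff_space Y -> dense S ->
  continuous f -> continuous g -> (forall x, S x -> f x = g x) -> f =1 g.
Proof.
move=> hY dS cf cg fg x.
have Sx : closure S x by rewrite (dense_closure dS).
have PF : ProperFilter (within S (nbhs x)) by exact: within_nbhs_proper.
apply: (@cvg_unique _ hY (f @ within S (nbhs x))).
  by apply: cvg_trans (cf x); apply: cvg_app; exact: cvg_within.
apply: cvg_trans (_ : g @ within S (nbhs x) --> _); last first.
  by apply: cvg_trans (cg x); apply: cvg_app; exact: cvg_within.
apply: near_eq_cvg; rewrite near_withinE.
by apply: nearW => y Sy; rewrite fg.
Qed.

End Dense.

(** * Inner products and bounded operators *)

Section Hilbert.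
Context {R : realType} {H : completeNormedModType R[i]}.
Variable dot : {dot H for @Num.conj R[i]}.
Hypothesis norm_dot : forall x : H, `|x| ^+ 2 = dot x x.

Lemma dot_conj x y : dot x y = (dot y x)^*.
Proof. by rewrite (hermC dot x y) expr0 mul1r. Qed.

Lemma dotZr a x y : dot x (a *: y) = a^* * dot x y.
Proof. by rewrite linearZr_LR. Qed.

Lemma dotZl a x y : dot (a *: x) y = a * dot x y.
Proof. by rewrite linearZl_LR. Qed.

(** Expressing [dot] through norms makes its joint continuity a consequence of
   the continuity of the norm. *)
Lemma dot_polarization x y : dot x y = 4^-1 *
  (`|x + y| ^+ 2 - `|x - y| ^+ 2
   + 'i * (`|x + 'i *: y| ^+ 2 - `|x - 'i *: y| ^+ 2)).
Proof.
rewrite !norm_dot !(linearDl, linearNl, linearDr, linearNr) /=.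
rewrite !dotZr !dotZl conjCi.
have I2 : 'i * 'i = -1 :> R[i] by rewrite -expr2 sqrCi.
set i := 'i in I2 *; set a := dot x y; set b := dot y x.
set c := dot x x; set d := dot y y.
transitivity (4^-1 * (2 * (a + b) - 2 * (i * i) * (a - b))).
  by rewrite I2; field.
by ring.
Qed.

Lemma cauchy_schwarz x y : `|dot x y| <= `|x| * `|y|.
Proof.
have [->|y0] := eqVneq y 0; first by rewrite linear0r !normr0 mulr0.
have ny : 0 < `|y| by rewrite normr_gt0.
rewrite -ler_sqr ?nnegrE ?mulr_ge0 // exprMn.
(* The vector below is the component of x orthogonal to y. *)
have : 0 <= `|x - (dot x y / `|y| ^+ 2) *: y| ^+ 2 by rewrite exprn_ge0.
rewrite norm_dot !(linearDl, linearNl, linearDr, linearNr) /= !dotZr !dotZl.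
rewrite -!norm_dot (dot_conj y x) normCK rmorphM /= fmorphV /= rmorphXn /=.
rewrite (conj_Creal (normr_real y)) => h.
rewrite -subr_ge0; apply: le_trans (mulr_ge0 (exprn_ge0 2 (ltW ny)) h) _.
rewrite le_eqVlt; apply/orP; left; apply/eqP; field.
by rewrite gt_eqF.
Qed.

Lemma cvg_dot {T : Type} (F : set_system T) {FF : Filter F} (f g : T -> H) a b :
  f @ F --> a -> g @ F --> b -> dot (f t) (g t) @[t --> F] --> dot a b.
Proof.
move=> fa gb; under eq_fun do rewrite dot_polarization.
rewrite dot_polarization.
have sq u v : u @ F --> v -> `|u x : H| ^+ 2 @[x --> F] --> `|v| ^+ 2.
  move=> uv; rewrite expr2; under eq_fun do rewrite expr2.
  by apply: cvgM; exact: cvg_norm.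
apply: cvgM; first exact: cvg_cst.
apply: cvgD; [|apply: cvgM; first exact: cvg_cst].
  by apply: cvgB; apply: sq; [exact: cvgD|exact: cvgB].
by apply: cvgB; apply: sq; [apply: cvgD => //|apply: cvgB => //]; exact: cvgZr.
Qed.

Lemma dot_inj_r y z : (forall x, dot x y = dot x z) -> y = z.
Proof.
move=> yz; apply/eqP; rewrite -subr_eq0 -normr_eq0 -sqrf_eq0 norm_dot.
by rewrite linearBr/= yz subrr.
Qed.

Lemma bounded_operator_continuous (A : {linear H -> H}) :
  bounded_operator A -> continuous A.
Proof.
move=> [M AM]; apply: bounded_linear_continuous; apply/linear_boundedP.
exists (M%:C)%C; split; first by rewrite realE !lecR -realE num_real.
by move=> r Mr x; rewrite (le_trans (AM x))// ler_wpM2r// ltW.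
Qed.

(** * Existence of the adjoint *)

Definition adjoint_domain (A : H -> H) : set H :=
  [set y | exists z, forall x, dot (A x) y = dot x z].

Lemma adjointE (A : H -> H) y : adjoint_domain A y ->
  forall x, dot (A x) y = dot x (adjoint dot A y).
Proof. by move=> /(xgetPex 0). Qed.

Lemma adjoint_uniq (A : H -> H) y z :
  (forall x, dot (A x) y = dot x z) -> adjoint dot A y = z.
Proof.
move=> yz; apply: dot_inj_r => x; rewrite -yz -adjointE //; by exists z.
Qed.

(** Testing the defining identity at [z] itself gives
   [`|z|^2 = dot (A z) y <= M * `|z| * `|y|].  Applied to a difference of two
   vectors [y], it is also the Lipschitz bound behind
   [adjoint_domain_closed]. *)
Lemma adjoint_norm_le (A : H -> H) (M : R[i]) y z :
  (forall x, `|A x| <= M * `|x|) ->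
  (forall x, dot (A x) y = dot x z) -> `|z| <= M * `|y|.
Proof.
move=> AM yz; have [->|z0] := eqVneq z 0.
  rewrite normr0; have := AM y.
  by apply: le_trans.
rewrite -(ler_pM2r (_ : 0 < `|z|)) ?normr_gt0// -expr2 norm_dot -yz.
have zz : 0 <= dot (A z) y by rewrite yz -norm_dot exprn_ge0.
rewrite -(ger0_norm zz) (le_trans (cauchy_schwarz _ _))// mulrAC.
by rewrite ler_wpM2r.
Qed.

(** Near a point [p] of the closure, the adjoint is Lipschitz on the domain, so
   its values along the trace on the domain of the neighbourhood filter of [p]
   form a Cauchy filter; by completeness they converge to some [z], and the
   identity [dot (A x) y = dot x z] passes to the limit. *)
Lemma adjoint_domain_closed (A : {linear H -> H}) :
  bounded_operator A -> closed (adjoint_domain A).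
Proof.
move=> [M0 AM0].
have [M M_gt0 AM] : exists2 M : R[i], 0 < M & forall x, `|A x| <= M * `|x|.
  exists (`|M0| + 1)%:C%C => [|x]; first by rewrite ltcR ltr_wpDl.
  rewrite (le_trans (AM0 x))// ler_wpM2r// lecR (le_trans (ler_norm _))//.
  by rewrite lerDl.
move=> p Yp; set F := within (adjoint_domain A) (nbhs p).
have PF : ProperFilter F by exact: within_nbhs_proper.
set S := adjoint dot A.
have S_lip y y' : adjoint_domain A y -> adjoint_domain A y' ->
    `|S y - S y'| <= M * `|y - y'|.
  move=> Yy Yy'; apply: adjoint_norm_le AM _ => x.
  by rewrite linearBr linearBr/= !adjointE.
have : cvg (S @ F).
  apply/cauchy_cvgP; apply: cauchy_exP => eps eps0.
  (* Points of the ball of radius del are less than 2 * del apart; S stretches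
     distances by at most M. *)
  pose del := eps / (2 * M).
  have del0 : 0 < del by rewrite divr_gt0// mulr_gt0.
  have [y0 [Yy0 py0]] := Yp _ (nbhsx_ballx p del del0).
  exists (S y0); change (\forall y \near F, ball (S y0) eps (S y)).
  rewrite near_withinE.
  apply: filterS (nbhsx_ballx p del del0) => y.
  rewrite -!ball_normE /ball_ /= => py Yy.
  rewrite (le_lt_trans (S_lip _ _ Yy0 Yy))//.
  have -> : eps = M * (del + del).
    by rewrite /del; field; apply: lt0r_neq0.
  rewrite ltr_pM2l// (le_lt_trans (ler_distD p _ _))// ltrD//.
  by move: py0; rewrite -ball_normE /ball_ /= distrC.
move=> /cvg_ex[z Sz]; exists z => x.
have hK : hausdorff_space (R[i] : numFieldType) by exact: norm_hausdorff.
apply: (cvg_unique hK (F := dot (A x) y @[y --> F])).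
  by apply: cvg_dot; [exact: cvg_cst|exact: cvg_within].
apply: cvg_trans (_ : dot x (S y) @[y --> F] --> _); last first.
  by apply: cvg_dot => //; exact: cvg_cst.
apply: near_eq_cvg; rewrite near_withinE.
by apply: nearW => y Yy; rewrite adjointE.
Qed.

Lemma adjoint_domain_lin_span (A : H -> H) (I : eqType) (e : I -> H) :
  (forall i, adjoint_domain A (e i)) -> lin_span e `<=` adjoint_domain A.
Proof.
move=> Ae x [s [c ->]].
exists (\sum_(i <- s) c i *: adjoint dot A (e i)) => x'.
rewrite !linear_sumr; apply: eq_bigr => i _.
by rewrite /= !dotZr adjointE.
Qed.

(** This takes the place of the Riesz representation theorem: it is enough to
   know representing vectors at the members of a family with dense span. *)
Lemma adjoint_linear (A : {linear H -> H}) (I : eqType) (e : I -> H) :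
  bounded_operator A -> dense (lin_span e) ->
  (forall i, adjoint_domain A (e i)) ->
  exists2 S : {linear H -> H}, adjoint dot A = S & bounded_operator S.
Proof.
move=> bA de Ae.
have Aall y x : dot (A x) y = dot x (adjoint dot A y).
  apply: adjointE; have /closure_id -> := adjoint_domain_closed bA.
  apply: (closure_subset (adjoint_domain_lin_span Ae)).
  by rewrite (dense_closure de).
have linS : linear (adjoint dot A).
  move=> a u v; apply: dot_inj_r => x.
  by rewrite -Aall !linearDr/= !dotZr !Aall.
pose L := GRing.isLinear.Build R[i] H H _ (adjoint dot A) linS.
pose S : {linear H -> H} := HB.pack (adjoint dot A) L.
exists S => //; case: bA => M AM; exists M => y.
exact: adjoint_norm_le AM (Aall y).
Qed.

Lemma adjoint_of_entries (A : {linear H -> H}) (I : eqType) (e : I -> H) y z :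
  dense (lin_span e) -> continuous A ->
  (forall i, dot (A (e i)) y = dot (e i) z) ->
  forall x, dot (A x) y = dot x z.
Proof.
move=> de cA Ae.
have hK : hausdorff_space (R[i] : numFieldType) by exact: norm_hausdorff.
apply: (eq_on_dense hK de) => [x|x|x [s [c ->]]].
- by apply: cvg_dot; [exact: cA|exact: cvg_cst].
- by apply: cvg_dot; [exact: cvg_id|exact: cvg_cst].
rewrite linear_sum !linear_sumlz; apply: eq_bigr => i _.
by rewrite linearZ/= !dotZl Ae.
Qed.

(** * Positivity of diagonal operators *)

Lemma diagonal_on_span (I : eqType) (e : I -> H) (F : {linear H -> H})
    (f : I -> R[i]) s c : (forall i, F (e i) = f i *: e i) ->
  F (\sum_(i <- s) c i *: e i) = \sum_(i <- s) (c i * f i) *: e i.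
Proof.
move=> Fe; rewrite linear_sum; apply: eq_bigr => i _.
by rewrite linearZ/= Fe scalerA.
Qed.

Lemma dot_sums (I : eqType) (e : I -> H) s (c c' : I -> R[i]) :
  dot (\sum_(i <- s) c i *: e i) (\sum_(i <- s) c' i *: e i) =
  \sum_(i <- s) \sum_(j <- s) c i * (c' j)^* * dot (e i) (e j).
Proof.
rewrite linear_sumlz; apply: eq_bigr => i _; rewrite linear_sumr.
by apply: eq_bigr => j _; rewrite /= dotZl dotZr mulrA.
Qed.

(** On a finite combination [x] of basis vectors with coefficients [c i],
   [dot (F x) x] is the squared norm of the combination with coefficients
   [c i * sqrtC (f i)]: both expand to the same double sum.  This comparison is
   insensitive to repeated indices, so the coefficients need not be regrouped.
   Positivity extends to all of [H] by density, being the equality of the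
   continuous functions [x |-> `|dot (F x) x|] and [x |-> dot (F x) x]. *)
Lemma diagonal_positiveP (I : eqType) (e : I -> H) (F : {linear H -> H})
    (f : I -> R[i]) :
  orthonormal_basis dot e -> continuous F -> (forall i, F (e i) = f i *: e i) ->
  positive_operator dot F <-> forall i, 0 <= f i.
Proof.
move=> [orth de] cF Fe; split=> [Fpos i|f0].
  by have := Fpos (e i); rewrite Fe dotZl orth eqxx mulr1.
have span_pos x : lin_span e x -> 0 <= dot (F x) x.
  move=> [s [c ->]]; rewrite (diagonal_on_span _ _ Fe).
  suff -> : dot (\sum_(i <- s) (c i * f i) *: e i) (\sum_(i <- s) c i *: e i) =
      `|\sum_(i <- s) (c i * sqrtC (f i)) *: e i| ^+ 2 by rewrite exprn_ge0.
  rewrite norm_dot !dot_sums; apply: eq_bigr => i _; apply: eq_bigr => j _.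
  rewrite orth; case: eqVneq => [<-|]; last by rewrite !mulr0.
  rewrite !mulr1 rmorphM /= [(sqrtC (f i))^*]conj_Creal ?ger0_real ?sqrtC_ge0//.
  rewrite -[in LHS](sqrtCK (f i)) expr2.
  by ring.
have cFx : continuous (fun x => dot (F x) x).
  by move=> x; apply: cvg_dot; [exact: cF|exact: cvg_id].
move=> x; rewrite ger0_def; apply/eqP; move: x.
have hK : hausdorff_space (R[i] : numFieldType) by exact: norm_hausdorff.
apply: (eq_on_dense hK de _ cFx) => [x|x /span_pos/ger0_norm//].
by apply: cvg_norm; exact: cFx.
Qed.

End Hilbert.

(** * Boundedness of the sequence *)

(** Both sides bound [`|b n|^2 * d' n / d n], the squared modulus of the family,
   uniformly in [n]: the left one by [m^-1], the right one by [M^2]. *)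
Lemma bounded_family_sqrtP (R : realType) (I : Type) (b d d' : I -> R[i]) :
  (forall n, 0 < d n) -> (forall n, 0 <= d' n) ->
  (exists2 m : R, 0 < m &
     forall n, 0 <= d n - (m%:C)%C * (`|b n| ^+ 2 * d' n)) <->
  bounded_family (fun n => b n * sqrtC (d' n / d n)).
Proof.
move=> d0 d'0.
have sq n : `|b n * sqrtC (d' n / d n)| ^+ 2 = `|b n| ^+ 2 * d' n / d n.
  rewrite normrM exprMn -[`|sqrtC _| ^+ 2]normrX sqrtCK.
  by rewrite (ger0_norm (divr_ge0 (d'0 n) (ltW (d0 n)))) mulrA.
split=> [[m m0 dm]|[M bM]].
  (* 1 + m^-1 bounds the square root of m^-1. *)
  exists (1 + m^-1) => n.
  have mi0 : 0 < m^-1 by rewrite invr_gt0.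
  have M0 : 0 <= ((1 + m^-1)%:C)%C :> R[i] by rewrite ler0c addr_ge0// ltW.
  rewrite -ler_sqr ?nnegrE// sq ler_pdivrMr//.
  apply: (@le_trans _ _ ((m^-1)%:C%C * d n)); last first.
    rewrite ler_pM2r// -rmorphXn lecR; nra.
  have := dm n; rewrite subr_ge0 => {}dm.
  have : (m^-1)%:C%C * (m%:C%C * (`|b n| ^+ 2 * d' n)) <= (m^-1)%:C%C * d n.
    by rewrite ler_wpM2l// ler0c ltW.
  by rewrite mulrA -rmorphM/= mulVf ?gt_eqF// mul1r.
(* The summand 1 keeps m positive when M is 0. *)
exists (M ^+ 2 + 1)^-1 => [|n]; first by rewrite invr_gt0 ltr_wpDl// sqr_ge0.
have K0 : 0 < M ^+ 2 + 1 by rewrite ltr_wpDl// sqr_ge0.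
have KC0 : 0 < ((M ^+ 2 + 1)%:C)%C :> R[i] by rewrite ltcR.
have M0 : 0 <= M%:C%C :> R[i] by exact: le_trans (bM n).
rewrite subr_ge0 fmorphV ler_pdivrMl//.
have := bM n; rewrite -ler_sqr ?nnegrE// sq ler_pdivrMr// => h.
apply: le_trans h _; rewrite ler_pM2r// -rmorphXn lecR.
by rewrite lerDl.
Qed.

(** * Bilateral weighted shifts *)

Section WeightedShift.
Context {R : realType} {H : completeNormedModType R[i]}.
Variable dot : {dot H for @Num.conj R[i]}.
Hypothesis norm_dot : forall x : H, `|x| ^+ 2 = dot x x.
Variables (e : int -> H) (beta : int -> R[i]) (T : {linear H -> H}).
Hypothesis e_basis : orthonormal_basis dot e.
Hypothesis T_bounded : bounded_operator T.
Hypothesis T_shift : forall n : int, T (e n) = beta n *: e (n + 1).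

Lemma shift_adjoint : exists S : {linear H -> H},
  [/\ adjoint dot T = S, continuous S &
      forall n, S (e n) = (beta (n - 1))^* *: e (n - 1)].
Proof.
have [orth de] := e_basis.
have Te n : forall x, dot (T x) (e n) = dot x ((beta (n - 1))^* *: e (n - 1)).
  have cT := bounded_operator_continuous T_bounded.
  apply: adjoint_of_entries de cT _ => // k.
  rewrite T_shift dotZl dotZr conjCK !orth.
  have -> : (k + 1 == n) = (k == n - 1) by rewrite eq_sym -subr_eq eq_sym.
  by case: eqVneq => [->|]; rewrite ?mulr0.
have [|S TS bS] := adjoint_linear norm_dot T_bounded de (e := e).
  by move=> n; exists ((beta (n - 1))^* *: e (n - 1)); exact: Te.
exists S; split => // [|n]; first exact: bounded_operator_continuous.
by rewrite -TS; exact: adjoint_uniq.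
Qed.

Let d n := `|beta n| ^+ 2 - `|beta (n - 1)| ^+ 2.

(** The difference [Q - m T^* Q T] is a bounded diagonal operator, with the
   entries displayed on the right-hand side. *)
Lemma shift_near_subnormal_wrtP :
  near_subnormal_wrt dot (self_commutator dot T) T <->
  exists2 m : R, 0 < m &
    forall n, 0 <= d n - m%:C%C * (`|beta n| ^+ 2 * d (n + 1)).
Proof.
have [S [TS cS Se]] := shift_adjoint.
have cT := bounded_operator_continuous T_bounded.
pose Q : {linear H -> H} := (S \o T) \- (T \o S).
have QE : self_commutator dot T = Q by rewrite /self_commutator TS.
have Qe n : Q (e n) = d n *: e n.
  rewrite /Q /= T_shift Se !linearZ /= Se T_shift addrK subrK.
  by rewrite scalerN !scalerA -scalerBl -normCK mulrC -normCK.
have cQ : continuous Q.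
  by move=> x; apply: cvgB; apply: continuous_comp; (exact: cT || exact: cS).
clearbody Q.
have SQTe n : S (Q (T (e n))) = (`|beta n| ^+ 2 * d (n + 1)) *: e n.
  rewrite T_shift linearZ /= Qe !linearZ /= Se addrK !scalerA normCK.
  by congr (_ *: _); ring.
rewrite QE /near_subnormal_wrt /operator_le TS.
have defectP (m : R) :
    positive_operator dot (Q \- (fun x => m%:C%C *: S (Q (T x)))) <->
    forall n, 0 <= d n - m%:C%C * (`|beta n| ^+ 2 * d (n + 1)).
  pose F : {linear H -> H} := Q \- (m%:C%C \*: (S \o (Q \o T))).
  apply: (@diagonal_positiveP _ _ _ norm_dot _ e F) => //.
    move=> x; apply: cvgB; first exact: cQ.
    apply: cvgZr; apply: continuous_comp; last exact: cS.
    by apply: continuous_comp; [exact: cT|exact: cQ].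
  by move=> n; rewrite /F /= Qe SQTe scalerA -scalerBl.
by split=> -[m m_gt0 /defectP Dm]; exists m.
Qed.

End WeightedShift.

Theorem theorem1 (R : realType) (H : completeNormedModType R[i])
    (dot : {dot H for @Num.conj R[i]})
    (norm_dot : forall x : H, `|x| ^+ 2 = dot x x)
    (H_separable : separable_space H)
    (e : int -> H) (e_basis : orthonormal_basis dot e)
    (beta : int -> R[i]) (beta_bounded : bounded_family beta)
    (T : {linear H -> H}) (T_bounded : bounded_operator T)
    (T_shift : forall n : int, T (e n) = beta n *: e (n + 1))
    (T_hyponormal : hyponormal dot T)
    (beta_incr : forall n : int, 0 < `|beta n| /\ `|beta n| < `|beta (n + 1)|) :
  near_subnormal dot T <->
  bounded_family (fun n : int =>
    beta n * sqrtC ((`|beta (n + 1)| ^+ 2 - `|beta n| ^+ 2) /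
                    (`|beta n| ^+ 2 - `|beta (n - 1)| ^+ 2))).
Proof.
pose d n := `|beta n| ^+ 2 - `|beta (n - 1)| ^+ 2.
have d_gt0 n : 0 < d n.
  rewrite subr_gt0 ltr_sqr ?nnegrE//.
  by have [_] := beta_incr (n - 1); rewrite subrK.
have dS n : `|beta (n + 1)| ^+ 2 - `|beta n| ^+ 2 = d (n + 1).
  by rewrite /d addrK.
under [X in bounded_family X]eq_fun do rewrite dS.
have wrtP := shift_near_subnormal_wrtP norm_dot e_basis T_bounded T_shift.
have bddP := bounded_family_sqrtP beta d_gt0 (fun n => ltW (d_gt0 (n + 1))).
split=> [[_ /wrtP/bddP//]|/bddP/wrtP//].
Qed.
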